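(* Let $\mathcal{C}^{\circ,\bullet}$ be a category of colored partitions, let $N$ be an integer and let $\mathbb{G}$ be the associated unitary easy quantum group. Let $p\in\mathcal{C}^{\circ,\bullet}(k,k)$ and $q\in\mathcal{C}^{\circ,\bullet}(l,l)$ be projective colored partitions. Then the representations $u_p$ and $u_q$ are unitarily equivalent if and only if either there exists $r\in\mathcal{C}^{\circ,\bullet}(k,l)$ such that $r^{*}r=p$ and $rr^{*}=q$, or $u_p=u_q=0$.
   Context: Colored partitions. A colored partition on $k$ upper points ($1,\dots,k$ from left to right) and $l$ lower points ($1',\dots,l'$) is a set-partition of the disjoint union of these points into blocks, together with a color (white or black) for each point; $P^{\circ,\bullet}(k,l)$ is the set of these. A through-block is a block containing both upper and lower points; $\beta(p)$ is the number of blocks that are not through-blocks. Colorings of a row of $k$ points are identified with words of length $k$ over $\mathbb{Z}_2=\{0,1\}$ (white $=0$, black $=1$). Operations: $p\otimes q$ is horizontal concatenation; $p^{*}$ is $p$ turned upside down; the composition $qp$ ($p$ on top, $q$ below, middle points identified and then removed) is defined when the lower coloring of $p$ equals the upper coloring of $q$; a rotation moves the leftmost (or rightmost) point of one row to the leftmost (resp. rightmost) position of the other row, keeping the blocks but changing the color of the moved point. The white identity is the one-block partition on one upper and one lower point, both white. A category of colored partitions $\mathcal{C}^{\circ,\bullet}$ is a collection of sets $\mathcal{C}^{\circ,\bullet}(k,l)\subseteq P^{\circ,\bullet}(k,l)$, $k,l\ge 0$, closed under these operations and containing the white identity. A colored partition $p$ is projective if $pp=p=p^{*}$ (so its upper and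 lower colorings coincide). For projective $p,q$ with the same coloring, $q\preceq p$ means $pq=q$, and $q\prec p$ means $q\preceq p$, $q\neq p$. Linear maps. Let $N\ge1$. For $p\in P^{\circ,\bullet}(k,l)$, $T_p:(\mathbb{C}^N)^{\otimes k}\to(\mathbb{C}^N)^{\otimes l}$ is $T_p(e_{i_1}\otimes\cdots\otimes e_{i_k})=N^{-\beta(p)/2}\sum_{j_1,\dots,j_l}\delta_p(i,j)e_{j_1}\otimes\cdots\otimes e_{j_l}$, where $\delta_p(i,j)=1$ if, labelling upper points by $i$ and lower points by $j$, points in a common block have equal labels, and $0$ otherwise (the coloring is ignored). Unitary easy quantum groups. For a representation $u$ put $u^0=u$, $u^1=\overline{u}$ (contragredient) and, for a word $w=w_1\cdots w_k$, $u^w=u^{w_1}\otimes\cdots\otimes u^{w_k}$. The unitary easy quantum group associated with $\mathcal{C}^{\circ,\bullet}$ and $N$ is the unique compact matrix quantum group $\mathbb{G}$ with $N$-dimensional fundamental representation $u$ (with $S_N\subset\mathbb{G}\subset U_N^+$) such that for all words $w,w'$ of lengths $k,l$, $\mathrm{Hom}(u^w,u^{w'})$ is spanned by the $T_p$ with $p\in\mathcal{C}^{\circ,\bullet}(k,l)$ of upper coloring $w$ and lower coloring $w'$. Representations $u_p$. For a projective $p\in\mathcal{C}^{\circ,\bullet}$ with coloring $w$, let $P_p=T_p-\bigvee_{q\prec p}T_q$, the supremum being over projective $q\in\mathcal{C}^{\circ,\bullet}$ with $q\prec p$, taken among projections of $\mathrm{Hom}(u^w,u^w)$, and let $u_p=(\iota\otimes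 P_p)(u^w)$ be the subrepresentation of $u^w$ on the range of $P_p$, where $\iota$ is the identity of $C(\mathbb{G})$ ($u_p$ may be zero). *)

(* Defs.v *)
From HB Require Import structures.
From mathcomp Require Import all_boot all_order all_algebra all_fingroup.
From mathcomp Require Import all_classical.
From mathcomp Require Import spectral sesquilinear.

Set Implicit Arguments.
Unset Strict Implicit.
Unset Printing Implicit Defensive.

Import Order.TTheory GRing.Theory Num.Theory.

Local Open Scope classical_set_scope.
Local Open Scope ring_scope.
Local Open Scope sesquilinear_scope.

(** * Colored partitions *)

(** [inl i] is the upper point [i], [inr j] the lower point [j'].  Colors are
    booleans: white is [false] and black is [true]. *)
Notation points k l := ('I_k + 'I_l)%type.

Record cpart (k l : nat) := CPart {
  cpart_data : {set {set points k l}} * {ffun points k l -> bool};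
  cpart_partition : finset.partition cpart_data.1 [set: points k l]%SET }.

HB.instance Definition _ k l := [isSub for @cpart_data k l].
HB.instance Definition _ k l := [Finite of cpart k l by <:].

Definition blocks k l (p : cpart k l) := (cpart_data p).1.
Definition color k l (p : cpart k l) := (cpart_data p).2.

(** The partition whose blocks are the nonempty fibres of [f]. *)
Definition part_by k l (rT : eqType) (f : points k l -> rT)
    (c : points k l -> bool) : cpart k l :=
  @CPart k l (preim_partition f [set: points k l]%SET, [ffun x => c x])
    (preim_partitionP f [set: points k l]%SET).

Definition upper k l (p : cpart k l) : k.-tuple bool :=
  [tuple color p (inl i) | i < k].
Definition lower k l (p : cpart k l) : l.-tuple bool :=
  [tuple color p (inr j) | j < l].

Definition block_of k l (p : cpart k l) (x : points k l) := finset.pblock (blocks p) x.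

Definition through k l (B : {set points k l}) :=
  [exists i, inl i \in B] && [exists j, inr j \in B].

Definition nonthrough k l (p : cpart k l) :=
  #|[set B in blocks p | ~~ through B]%SET|.

Definition white_id : cpart 1 1 := part_by (fun _ => tt) (fun _ => false).

(** Each point of the concatenation comes from a point of [p] or one of [q]. *)
Definition split_point k l k' l' (x : points (k + k') (l + l')) :
    points k l + points k' l' :=
  match x with
  | inl i => match fintype.split i with inl a => inl (inl a) | inr b => inr (inl b) end
  | inr j => match fintype.split j with inl a => inl (inr a) | inr b => inr (inr b) end
  end.

Definition part_tensor k l k' l' (p : cpart k l) (q : cpart k' l') :
    cpart (k + k') (l + l') :=
  part_by
    (fun x => match split_point x with
              | inl y => inl (block_of p y) | inr z => inr (block_of q z) end)
    (fun x => match split_point x with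
              | inl y => color p y | inr z => color q z end).

Definition swap_points k l (x : points k l) : points l k :=
  match x with inl i => inr i | inr j => inl j end.

Definition part_adj k l (p : cpart k l) : cpart l k :=
  part_by (fun x => block_of p (swap_points x))
          (fun x => color p (swap_points x)).

(** Composition takes place on three rows of points: [inl (inl i)] is upper,
    [inl (inr j)] is in the middle and [inr m] is lower. *)
Definition outer_point k l m (x : points k m) : 'I_k + 'I_l + 'I_m :=
  match x with inl i => inl (inl i) | inr j => inr j end.

Definition bottom_point k l m (x : points l m) : 'I_k + 'I_l + 'I_m :=
  match x with inl i => inl (inr i) | inr j => inr j end.

Definition linked k l m (q : cpart l m) (p : cpart k l) :
    rel ('I_k + 'I_l + 'I_m) :=
  fun x y =>
    [exists B in blocks p, (x \in [set inl z | z in B]%SET) &&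
                           (y \in [set inl z | z in B]%SET)]
 || [exists B in blocks q, (x \in [set bottom_point k z | z in B]%SET) &&
                           (y \in [set bottom_point k z | z in B]%SET)].

Definition composable k l m (q : cpart l m) (p : cpart k l) :=
  lower p == upper q.

(** [part_comp q p] is [qp]: [p] on top of [q].  It is meaningful only when
    [composable q p]; the relation [linked q p] is symmetric, so equality of the
    sets below is connectedness through the middle row. *)
Definition part_comp k l m (q : cpart l m) (p : cpart k l) : cpart k m :=
  part_by (fun x => [set z | connect (linked q p) (outer_point l x) z]%SET)
          (fun x => match x with
                    | inl i => color p (inl i) | inr j => color q (inr j) end).

(** The point of [p] that occupies position [x] once the upper point [a] has
    been moved to the lower position [b]. *)
Definition unrotate k l (a : 'I_k.+1) (b : 'I_l.+1) (x : points k l.+1) :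
    points k.+1 l :=
  match x with
  | inl i => inl (lift a i)
  | inr j => if unlift b j is Some j' then inr j' else inl a
  end.

Definition rot_down k l (a : 'I_k.+1) (b : 'I_l.+1) (p : cpart k.+1 l) :
    cpart k l.+1 :=
  part_by (fun x => block_of p (unrotate a b x))
          (fun x => (x == inr b) (+) color p (unrotate a b x)).

Definition rot_up k l (a : 'I_k.+1) (b : 'I_l.+1) (p : cpart k l.+1) :
    cpart k.+1 l :=
  part_adj (rot_down b a (part_adj p)).

Record is_category (Cat : forall k l, {set cpart k l}) : Prop := IsCategory {
  cat_id : white_id \in Cat 1%N 1%N;
  cat_tensor : forall k l k' l' (p : cpart k l) (q : cpart k' l'),
    p \in Cat k l -> q \in Cat k' l' -> part_tensor p q \in Cat (k + k')%N (l + l')%N;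
  cat_adj : forall k l (p : cpart k l), p \in Cat k l -> part_adj p \in Cat l k;
  cat_comp : forall k l m (q : cpart l m) (p : cpart k l),
    q \in Cat l m -> p \in Cat k l -> composable q p -> part_comp q p \in Cat k m;
  cat_rot_down_left : forall k l (p : cpart k.+1 l),
    p \in Cat k.+1 l -> rot_down ord0 ord0 p \in Cat k l.+1;
  cat_rot_down_right : forall k l (p : cpart k.+1 l),
    p \in Cat k.+1 l -> rot_down ord_max ord_max p \in Cat k l.+1;
  cat_rot_up_left : forall k l (p : cpart k l.+1),
    p \in Cat k l.+1 -> rot_up ord0 ord0 p \in Cat k.+1 l;
  cat_rot_up_right : forall k l (p : cpart k l.+1),
    p \in Cat k l.+1 -> rot_up ord_max ord_max p \in Cat k.+1 l }.

Definition projective k (p : cpart k k) := part_comp p p = p /\ p = part_adj p.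

Definition preceq k (q p : cpart k k) := upper q = upper p /\ part_comp p q = q.

Definition prec k (q p : cpart k k) := preceq q p /\ q <> p.

(** * Linear maps *)

(** The canonical basis of (C^N)^{⊗k} is indexed by [k.-tuple 'I_N], transported
    to ordinals by [enum_val]. *)
Definition tdim (N k : nat) := #|{: k.-tuple 'I_N}|.

Definition point_label N k l (i : k.-tuple 'I_N) (j : l.-tuple 'I_N)
    (x : points k l) : 'I_N :=
  match x with inl a => tnth i a | inr b => tnth j b end.

Definition delta_part k l (p : cpart k l) N (i : k.-tuple 'I_N) (j : l.-tuple 'I_N) :=
  [forall B in blocks p, forall x in B, forall y in B,
     point_label i j x == point_label i j y].

Definition Tmap (C : numClosedFieldType) (N : nat) k l (p : cpart k l) :
    'M[C]_(tdim N l, tdim N k) :=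
  (sqrtC N%:R)^-1 ^+ nonthrough p *:
  \matrix_(j, i) (delta_part p (enum_val i) (enum_val j))%:R.

Definition is_projection (C : numClosedFieldType) n (P : 'M[C]_n) :=
  P *m P = P /\ P ^t* = P.

Definition proj_le (C : numClosedFieldType) n (P Q : 'M[C]_n) := Q *m P = P.

(** The least upper bound of [F] among the projections belonging to [H]. *)
Definition is_projsup (C : numClosedFieldType) n (H F : set 'M[C]_n)
    (S : 'M[C]_n) :=
  [/\ is_projection S, H S, (forall Q, F Q -> proj_le Q S) &
      forall S', is_projection S' -> H S' ->
        (forall Q, F Q -> proj_le Q S') -> proj_le S S'].

Definition projsup (C : numClosedFieldType) n (H F : set 'M[C]_n) : 'M[C]_n :=
  xget 0 [set S | is_projsup H F S].

(** * C*-algebras *)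

(** The norm takes values in the nonnegative elements of the scalar field, as the
    library's norms do.  (Algebras are not joined with normed modules in the
    hierarchy of structures, so the Banach space axioms are listed.) *)
Record cstarType (C : numClosedFieldType) := CStar {
  cstar_alg :> algType C;
  star : cstar_alg -> cstar_alg;
  cnorm : cstar_alg -> C;
  starK : involutive star;
  starD : {morph star : x y / x + y};
  starZ : forall (a : C) x, star (a *: x) = a^* *: star x;
  starM : forall x y, star (x * y) = star y * star x;
  cnorm_ge0 : forall x, 0 <= cnorm x;
  cnorm_eq0 : forall x, cnorm x = 0 -> x = 0;
  cnormD : forall x y, cnorm (x + y) <= cnorm x + cnorm y;
  cnormZ : forall (a : C) x, cnorm (a *: x) = `|a| * cnorm x;
  cnormM : forall x y, cnorm (x * y) <= cnorm x * cnorm y;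
  cnorm_cstar : forall x, cnorm (star x * x) = cnorm x ^+ 2;
  cnorm_complete : forall x_ : nat -> cstar_alg,
    (forall e, 0 < e -> exists n0, forall m n, (n0 <= m)%N -> (n0 <= n)%N ->
       cnorm (x_ m - x_ n) < e) ->
    exists x, forall e, 0 < e -> exists n0, forall n, (n0 <= n)%N ->
       cnorm (x_ n - x) < e }.

Arguments star {C c} x.
Arguments cnorm {C c} x.

Definition norm_dense (C : numClosedFieldType) (A : cstarType C) (S : set A) :=
  forall x e, 0 < e -> exists2 y, S y & cnorm (x - y) < e.

Definition star_hom (C : numClosedFieldType) (A B : cstarType C)
    (f : {lrmorphism A -> B}) := forall x, f (star x) = star (f x).

(** A C*-completion of the algebraic tensor product of [A1] and [A2]:
    the elementary tensor of [a] and [b] is [tin1 a * tin2 b]. *)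
Record cstar_tensor (C : numClosedFieldType) (A1 A2 : cstarType C) :=
    CStarTensor {
  tcarrier :> cstarType C;
  tin1 : {lrmorphism A1 -> tcarrier};
  tin2 : {lrmorphism A2 -> tcarrier};
  tin1_star : star_hom tin1;
  tin2_star : star_hom tin2;
  tin_comm : forall a b, tin1 a * tin2 b = tin2 b * tin1 a;
  tin_inj : forall n (a : 'I_n -> A1) (b : 'I_n -> A2),
    (forall c : 'I_n -> C, \sum_i c i *: a i = 0 -> forall i, c i = 0) ->
    \sum_i tin1 (a i) * tin2 (b i) = 0 -> forall i, b i = 0;
  tin_dense : norm_dense [set x : tcarrier | exists s : seq (A1 * A2),
    x = \sum_(t <- s) tin1 t.1 * tin2 t.2] }.

(** The minimal (spatial) C*-tensor product, characterized by the minimality of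
    its norm among all C*-norms on the algebraic tensor product. *)
Definition is_min_tensor (C : numClosedFieldType) (A1 A2 : cstarType C)
    (T : cstar_tensor A1 A2) :=
  forall (T' : cstar_tensor A1 A2) (s : seq (A1 * A2)),
    cnorm (\sum_(t <- s) tin1 T t.1 * tin2 T t.2)
      <= cnorm (\sum_(t <- s) tin1 T' t.1 * tin2 T' t.2).

(** * Compact matrix quantum groups *)

Section MatricesOverCStar.
Variables (C : numClosedFieldType) (A : cstarType C).

Definition star_mx m n (v : 'M[A]_(m, n)) : 'M[A]_(m, n) := map_mx (fun x => star x) v.

Definition unitary_mx n (v : 'M[A]_n) :=
  (star_mx v)^T *m v = 1%:M /\ v *m (star_mx v)^T = 1%:M.

Definition invertible_mx n (v : 'M[A]_n) :=
  exists w, w *m v = 1%:M /\ v *m w = 1%:M.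

Definition scal_mx m n (T : 'M[C]_(m, n)) : 'M[A]_(m, n) :=
  map_mx (fun a => a%:A) T.

Definition star_subalgebra (S : set A) :=
  [/\ S 1, (forall x y, S x -> S y -> S (x + y)),
      (forall x y, S x -> S y -> S (x * y)),
      (forall a x, S x -> S (a *: x)) & forall x, S x -> S (star x)].

Definition star_generated n (v : 'M[A]_n) : set A :=
  [set x | forall S, star_subalgebra S -> (forall i j, S (v i j)) -> S x].

End MatricesOverCStar.

Record cmqg (C : numClosedFieldType) (N : nat) := CMQG {
  calg : cstarType C;
  fund : 'M[calg]_N;
  ctens : cstar_tensor calg calg;
  ctens_min : is_min_tensor ctens;
  comult : {lrmorphism calg -> ctens};
  comult_star : star_hom comult;
  comult_fund : forall i j, comult (fund i j) =
    \sum_k tin1 ctens (fund i k) * tin2 ctens (fund k j);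
  fund_dense : norm_dense (star_generated fund);
  fund_inv : invertible_mx fund;
  fund_bar_inv : invertible_mx (star_mx fund) }.

Section QuantumGroup.
Variables (C : numClosedFieldType) (N : nat) (G : cmqg C N).

(** [G] is a quantum subgroup of U_N^+: [calg G] is a quotient of the universal
    C*-algebra generated by the coefficients of a matrix that is unitary
    together with its entrywise adjoint. *)
Definition sub_UNplus := unitary_mx (fund G) /\ unitary_mx (star_mx (fund G)).

(** S_N is a quantum subgroup of [G]: the coefficients of the fundamental
    representation can be sent to the coordinate functions on permutation
    matrices.  The *-morphism to C(S_N) is given pointwise, and is defined on
    the dense *-subalgebra only, since [calg G] need not be the universal
    completion. *)
Definition contains_SN := forall s : 'S_N, exists chi : calg G -> C,
  let Pol := star_generated (fund G) in
  [/\ chi 1 = 1 /\ (forall x y, Pol x -> Pol y -> chi (x + y) = chi x + chi y),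
      (forall x y, Pol x -> Pol y -> chi (x * y) = chi x * chi y),
      (forall a x, Pol x -> chi (a *: x) = a * chi x),
      (forall x, Pol x -> chi (star x) = (chi x)^*) &
      forall i j, chi (fund G i j) = (i == s j)%:R].

Definition letter_rep (c : bool) : 'M[calg G]_N :=
  if c then star_mx (fund G) else fund G.

(** u^w, a matrix over C(G) acting on (C^N)^{⊗k} *)
Definition word_rep k (w : k.-tuple bool) : 'M[calg G]_(tdim N k) :=
  \matrix_(i, j) \prod_(a < k)
    letter_rep (tnth w a) (tnth (enum_val i) a) (tnth (enum_val j) a).

Definition Hom m n (v : 'M[calg G]_m) (w : 'M[calg G]_n) : set 'M[C]_(n, m) :=
  [set T | scal_mx (calg G) T *m v = w *m scal_mx (calg G) T].

Definition corner_rep n (P : 'M[C]_n) (v : 'M[calg G]_n) : 'M[calg G]_n :=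
  scal_mx (calg G) P *m v.

(** Unitary equivalence of a representation [v] on the range of the projection
    [P] and a representation [w] on the range of the projection [Q].  A unitary
    map between the two ranges, extended by zero on the orthogonal complement,
    is a matrix [V] with V^*V = P and VV^* = Q. *)
Definition unitarily_equivalent m n (P : 'M[C]_m) (v : 'M[calg G]_m)
    (Q : 'M[C]_n) (w : 'M[calg G]_n) :=
  exists V : 'M[C]_(n, m),
    [/\ V ^t* *m V = P, V *m V ^t* = Q &
        scal_mx (calg G) V *m v = w *m scal_mx (calg G) V].

Variable Cat : forall k l, {set cpart k l}.

Record unitary_easy : Prop := UnitaryEasy {
  easy_sub_UNplus : sub_UNplus;
  easy_contains_SN : contains_SN;
  easy_Hom : forall k l (w : k.-tuple bool) (w' : l.-tuple bool)
      (T : 'M[C]_(tdim N l, tdim N k)),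
    Hom (word_rep w) (word_rep w') T <->
    T \in <<[seq Tmap C N p | p in
      [set p in Cat k l | (upper p == w) && (lower p == w')]%SET]>>%VS }.

(** P_p *)
Definition part_proj k (p : cpart k k) : 'M[C]_(tdim N k) :=
  Tmap C N p -
  projsup (Hom (word_rep (upper p)) (word_rep (upper p)))
    [set T | exists q, [/\ q \in Cat k k, projective q, prec q p &
                           T = Tmap C N q]].

(** u_p, carried by the range of [part_proj p] *)
Definition part_rep k (p : cpart k k) : 'M[calg G]_(tdim N k) :=
  corner_rep (part_proj p) (word_rep (upper p)).

End QuantumGroup.

(* Main.v *)
Require Import Defs.
From mathcomp Require Import all_boot all_order all_algebra all_fingroup.
From mathcomp Require Import all_classical reals complex.
From mathcomp Require Import spectral sesquilinear.
Import Defs.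

(** Everything rests on reading a partition [p] as a relation between labellings
    of its upper and lower points, the pairs of labellings that are constant on
    the blocks. Composition of partitions is then composition of relations, the
    adjoint is the converse relation, and labels in [bool] are enough to recover
    the partition. Associativity, [(q p)* = p* q*] and [r r* r = r] thus become
    statements about relations; the last one is difunctionality. With labels in
    Z/N the relations are subgroups, so the number of middle labellings in a
    composition is the same for all compatible outer labellings, and
    [T_q T_p = c T_(q p)] with [c > 0] ([Tmap_comp]). For projective [p] the
    normalization makes [T_p] a projection ([Tmap_projection]).

    The spaces [Hom(u^w, u^w)] are *-algebras of matrices, hence contain the range
    projection of each of their Hermitian elements, a polynomial in it. So the
    supremum of the [T_q] with [q] strictly below [p] exists
    ([projsup_exists]), it lies below [T_p], and [P_p] is a projection killed by
    all these [T_q].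

    If [r* r = p] and [r r* = q], a multiple [V] of [T_r] is a partial isometry
    from the range of [T_p] onto the range of [T_q]. Conjugation by [V] matches the
    partitions strictly below [p] with those strictly below [q], so it carries one
    supremum to the other, and [V P_p] is an equivalence of [u_p] and [u_q]. When
    both representations vanish, so do [P_p] and [P_q], because the counit maps
    [u^w] to the identity ([corner_word_rep_eq0]); then [0] is an equivalence.

    Conversely an equivalence is an intertwiner [V = P_q V P_p], a combination of
    the [P_q T_r P_p]. If it is not zero, neither is one of these terms, and [r]
    may be replaced by [q r p]. As [T_r] is a multiple of [T_r T_(r* r)], the
    partition [r* r], which is below [p], cannot be strictly below it; likewise
    [r r* = q] ([part_proj_intertwiner]). *)

Set Implicit Arguments.
Unset Strict Implicit.
Unset Printing Implicit Defensive.

Import Order.TTheory GRing.Theory Num.Theory.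

Local Open Scope ring_scope.
Local Open Scope sesquilinear_scope.

(** * Partitions as relations between labellings *)

Section Blocks.
Variables k l : nat.
Implicit Types (p : cpart k l) (x y : points k l).

Lemma cover_blocks p : finset.cover (blocks p) = [set: points k l]%SET.
Proof. exact: finset.cover_partition (cpart_partition p). Qed.

Lemma trivIset_blocks p : finset.trivIset (blocks p).
Proof. exact: partition_trivIset (cpart_partition p). Qed.

Lemma block_of_mem p x : block_of p x \in blocks p.
Proof. by apply: pblock_mem; rewrite cover_blocks inE. Qed.

Lemma mem_block_of p x : x \in block_of p x.
Proof. by rewrite finset.mem_pblock cover_blocks inE. Qed.

Lemma block_ofP p B x : B \in blocks p -> (x \in B) = (block_of p x == B).
Proof.
move=> pB; apply/idP/eqP => [xB|<-]; last exact: mem_block_of.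
exact: def_pblock (trivIset_blocks p) pB xB.
Qed.

Lemma block_of_part_by (rT : eqType) (f : points k l -> rT) c x y :
  (block_of (part_by f c) x == block_of (part_by f c) y) = (f x == f y).
Proof.
rewrite eq_pblock ?trivIset_blocks ?cover_blocks ?inE //.
rewrite pblock_equivalence_partition ?inE //.
by split=> [|/eqP->]; rewrite ?eqxx.
Qed.

Lemma eq_cpart p p' :
  (forall x y, (block_of p x == block_of p y) = (block_of p' x == block_of p' y)) ->
  color p =1 color p' -> p = p'.
Proof.
move=> eq_pp' eq_c; apply: val_inj => /=.
rewrite [cpart_data p]surjective_pairing [cpart_data p']surjective_pairing.
congr (_, _); last exact/ffunP.
rewrite -(preim_partition_pblock (cpart_partition p)).
rewrite -(preim_partition_pblock (cpart_partition p')).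
apply: eq_imset => x; apply/setP => y; rewrite !inE; exact: eq_pp'.
Qed.

End Blocks.

Section Relations.
Variables k l : nat.

Definition glue (L : Type) (i : 'I_k -> L) (j : 'I_l -> L) (x : points k l) : L :=
  match x with inl a => i a | inr b => j b end.

(** The set of pairs of labellings with [delta_p = 1], for labels in any type. *)
Definition rel_of (p : cpart k l) (L : Type) (i : 'I_k -> L) (j : 'I_l -> L) :=
  forall x y, block_of p x = block_of p y -> glue i j x = glue i j y.

(** Two labels suffice to recover a partition from its relation: the indicator
    function of a block of [p'] separates that block from the other points. *)
Lemma rel_of_inj (p p' : cpart k l) :
  (forall i j : _ -> bool, rel_of p i j <-> rel_of p' i j) ->
  color p =1 color p' -> p = p'.
Proof.
move=> eqpp'; apply: eq_cpart => x y.
have ind (s : cpart k l) z : exists i j,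
    forall t, glue i j t = (block_of s t == block_of s z).
  exists (fun a => block_of s (inl a) == block_of s z).
  by exists (fun b => block_of s (inr b) == block_of s z); case.
apply/eqP/eqP => [eqp|eqp'].
- have [i [j ijE]] := ind p' x.
  have /eqpp' /(_ _ _ eqp): rel_of p' i j by move=> a b eab; rewrite !ijE eab.
  by rewrite !ijE eqxx => /esym/eqP/esym.
- have [i [j ijE]] := ind p x.
  have /eqpp' /(_ _ _ eqp'): rel_of p i j by move=> a b eab; rewrite !ijE eab.
  by rewrite !ijE eqxx => /esym/eqP/esym.
Qed.

Lemma delta_partP (p : cpart k l) N (i : k.-tuple 'I_N) (j : l.-tuple 'I_N) :
  reflect (rel_of p (tnth i) (tnth j)) (delta_part p i j).
Proof.
have lblE x : point_label i j x = glue (tnth i) (tnth j) x by case: x.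
apply: (iffP forall_inP) => [dp x y exy|dp B pB].
- rewrite -!lblE; apply/eqP.
  have /forall_inP/(_ x (mem_block_of p x))/forall_inP := dp _ (block_of_mem p x).
  by apply; rewrite exy mem_block_of.
- apply/forall_inP => x xB; apply/forall_inP => y yB; rewrite !lblE.
  apply/eqP/dp; move: xB yB; rewrite !(block_ofP _ pB) => /eqP-> /eqP->; exact: erefl.
Qed.

(** The relation is linear over the labels; its nonempty fibres are therefore
    cosets of a common group. *)
Lemma rel_of_add (L : zmodType) (p : cpart k l) (i i' : 'I_k -> L) (j j' : 'I_l -> L) :
  rel_of p i j ->
  rel_of p (fun a => i' a + i a) (fun b => j' b + j b) <-> rel_of p i' j'.
Proof.
have gD x : glue (fun a => i' a + i a) (fun b => j' b + j b) x
            = glue i' j' x + glue i j x by case: x.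
move=> pij; split=> h x y exy; have := h x y exy; rewrite ?gD.
- by rewrite (pij _ _ exy) => /addIr.
- by move->; rewrite (pij _ _ exy).
Qed.

Lemma eq_rel_of (p : cpart k l) (L : Type) (i i' : 'I_k -> L) (j j' : 'I_l -> L) :
  i =1 i' -> j =1 j' -> rel_of p i j -> rel_of p i' j'.
Proof.
move=> ei ej h x y exy; have gE z : glue i' j' z = glue i j z by case: z => a /=.
by rewrite !gE; apply: h.
Qed.

(** Relations of partitions are difunctional: an upper point and a lower point in
    the same block carry the label shared along the zigzag. *)
Lemma rel_of_difunctional (p : cpart k l) (L : Type) (i i' : 'I_k -> L)
    (j j' : 'I_l -> L) :
  rel_of p i j -> rel_of p i' j -> rel_of p i' j' -> rel_of p i j'.
Proof.
move=> h1 h2 h3 [a|a] [b|b] e /=.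
- exact: (h1 _ _ e).
- by rewrite [LHS](h1 _ _ e) -[LHS](h2 _ _ e) [LHS](h3 _ _ e).
- have e' := esym e.
  by rewrite [RHS](h1 _ _ e') -[RHS](h2 _ _ e') [RHS](h3 _ _ e').
- exact: (h3 _ _ e).
Qed.

Lemma rel_of_cst (p : cpart k l) (L : Type) (z : L) :
  rel_of p (fun=> z) (fun=> z).
Proof. by move=> [a|a] [b|b] _. Qed.

End Relations.

Lemma color_part_by k l (rT : eqType) (f : points k l -> rT) c :
  color (part_by f c) =1 c.
Proof. by move=> x; rewrite /color /= ffunE. Qed.

Lemma rel_of_adj k l (p : cpart k l) (L : Type) (i : 'I_k -> L) (j : 'I_l -> L) :
  rel_of (part_adj p) j i <-> rel_of p i j.
Proof.
have gE x : glue j i (swap_points x) = glue i j x by case: x.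
have sK a b (x : points a b) : swap_points (swap_points x) = x by case: x.
split=> h x y exy.
- by rewrite -!gE; apply/h/eqP; rewrite block_of_part_by !sK exy.
- rewrite -[x]sK -[y]sK !gE; apply: h.
  by move/eqP: exy; rewrite block_of_part_by => /eqP.
Qed.

Lemma adjK k l (p : cpart k l) : part_adj (part_adj p) = p.
Proof.
apply: rel_of_inj => [i j|]; first by rewrite !rel_of_adj.
by move=> [a|a]; rewrite !color_part_by.
Qed.

(** A middle labelling is found by propagating the labels of the outer points
    along connected components; components without outer points take [l0]. *)
Lemma rel_of_comp k l m (q : cpart l m) (p : cpart k l) (L : Type) (l0 : L)
    (i : 'I_k -> L) (h : 'I_m -> L) :
  rel_of (part_comp q p) i h <-> exists j, rel_of p i j /\ rel_of q j h.
Proof.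
set op := @outer_point k l m; set e := linked q p.
have linkP x y : e x y <->
    (exists a b, [/\ x = inl a, y = inl b & block_of p a = block_of p b]) \/
    (exists a b, [/\ x = bottom_point k a, y = bottom_point k b
                   & block_of q a = block_of q b]).
  split=> [/orP[]/exists_inP[B pB /andP[/imsetP[a aB ->] /imsetP[b bB ->]]]|].
  - left; exists a, b; split=> //.
    by move: aB bB; rewrite !(block_ofP _ pB) => /eqP-> /eqP->.
  - right; exists a, b; split=> //.
    by move: aB bB; rewrite !(block_ofP _ pB) => /eqP-> /eqP->.
  - case=> -[a [b [-> -> eab]]]; apply/orP; [left|right]; apply/exists_inP.
    + exists (block_of p a); first exact: block_of_mem.
      by rewrite !imset_f ?mem_block_of // eab mem_block_of.
    + exists (block_of q a); first exact: block_of_mem.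
      by rewrite !imset_f ?mem_block_of // eab mem_block_of.
have csym : connect_sym e.
  apply: sym_connect_sym => x y; rewrite /e /linked.
  by congr (_ || _); apply: eq_existsb => B; rewrite [X in _ && X]andbC.
have blockE x y : (block_of (part_comp q p) x == block_of (part_comp q p) y)
    = connect e (op x) (op y).
  rewrite block_of_part_by; apply/eqP/idP => [/setP/(_ (op y))|cxy].
    by rewrite !inE connect0.
  by apply/setP => z; rewrite !inE; apply: (same_connect csym).
split=> [comp_ih|[j [pij qjh]] x y /eqP]; last first.
  pose lab z : L := match z with inl a => glue i j a | inr c => h c end.
  have labE a : lab (bottom_point k a) = glue j h a by case: a.
  have labO a : glue i h a = lab (op a) by case: a.
  have lab_e a b : e a b -> lab a = lab b.
    by move=> /linkP[|] [a' [b' [-> -> /[dup] eab]]]; rewrite ?labE;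
      [exact: pij | exact: qjh].
  rewrite blockE !labO => /connectP[s]; elim: s (op x) => [|c s IHs] z /= => [_ -> //|].
  by case/andP=> /lab_e-> /IHs.
pose att z := [pick x | connect e (op x) z].
pose lab z := if att z is Some x then glue i h x else l0.
have eq_outer x y : connect e (op x) (op y) -> glue i h x = glue i h y.
  by rewrite -blockE => /eqP; apply: comp_ih.
have lab_e a b : e a b -> lab a = lab b.
  move=> /connect1 cab; rewrite /lab /att.
  have eqab x : connect e (op x) a = connect e (op x) b.
    by rewrite ![connect e (op x) _]csym; apply: (same_connect csym).
  case: pickP => [x xa|noa]; case: pickP => [y yb|nob] //.
  - by apply: eq_outer; rewrite eqab in xa; rewrite (same_connect csym xa) csym.
  - by have := nob x; rewrite -eqab xa.
  - by have := noa y; rewrite eqab yb.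
have labO x : lab (op x) = glue i h x.
  rewrite /lab /att; case: pickP => [y /eq_outer //|/(_ x)].
  by rewrite connect0.
exists (fun b => lab (inl (inr b))); split=> x y exy.
- have gE z : glue i (fun b => lab (inl (inr b))) z = lab (inl z).
    case: z => a //; exact: esym (labO (inl a)).
  by rewrite !gE; apply/lab_e/linkP; left; exists x, y.
- have gE z : glue (fun b => lab (inl (inr b))) h z = lab (bottom_point k z).
    case: z => a //; exact: esym (labO (inr a)).
  by rewrite !gE; apply/lab_e/linkP; right; exists x, y.
Qed.

(** * The *-calculus of partitions *)

Section Calculus.
Variables k l : nat.
Implicit Types r : cpart k l.

Lemma part_compA m n (s : cpart m n) (q : cpart l m) r :
  part_comp s (part_comp q r) = part_comp (part_comp s q) r.
Proof.
apply: rel_of_inj => [i h|]; last by move=> [a|a]; rewrite !color_part_by.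
rewrite !(rel_of_comp _ _ true).
split=> [[j [/(rel_of_comp _ _ true)[j' [? ?]] ?]]|[j [? /(rel_of_comp _ _ true)[j' [? ?]]]]].
- by exists j'; split=> //; apply/(rel_of_comp _ _ true); exists j.
- by exists j'; split=> //; apply/(rel_of_comp _ _ true); exists j.
Qed.

Lemma part_adj_comp m (q : cpart l m) r :
  part_adj (part_comp q r) = part_comp (part_adj r) (part_adj q).
Proof.
apply: rel_of_inj => [i h|]; last by move=> [a|a]; rewrite !color_part_by.
rewrite rel_of_adj !(rel_of_comp _ _ true).
by split=> -[j [? ?]]; exists j; rewrite ?rel_of_adj; split=> //; apply/rel_of_adj.
Qed.

Lemma part_comp_adj_comp r : part_comp r (part_comp (part_adj r) r) = r.
Proof.
apply: rel_of_inj => [i h|]; last by move=> [a|a]; rewrite !color_part_by.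
rewrite (rel_of_comp _ _ true); split=> [[j []]|rih].
- move/(rel_of_comp _ _ true) => [h' [rih' /rel_of_adj rjh'] rjh].
  exact: rel_of_difunctional rih' rjh' rjh.
- exists i; split=> //; apply/(rel_of_comp _ _ true); exists h.
  by split=> //; apply/rel_of_adj.
Qed.

Lemma upper_adj r : upper (part_adj r) = lower r.
Proof. by apply: eq_from_tnth => a; rewrite !tnth_mktuple color_part_by. Qed.

Lemma lower_adj r : lower (part_adj r) = upper r.
Proof. by apply: eq_from_tnth => a; rewrite !tnth_mktuple color_part_by. Qed.

Lemma upper_comp m (q : cpart l m) r : upper (part_comp q r) = upper r.
Proof. by apply: eq_from_tnth => a; rewrite !tnth_mktuple color_part_by. Qed.

Lemma lower_comp m (q : cpart l m) r : lower (part_comp q r) = lower q.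
Proof. by apply: eq_from_tnth => a; rewrite !tnth_mktuple color_part_by. Qed.

End Calculus.

Lemma projective_lower k (p : cpart k k) : projective p -> lower p = upper p.
Proof. by case=> _ pE; rewrite {1}pE lower_adj. Qed.

Lemma projective_gram k l (r : cpart k l) : projective (part_comp (part_adj r) r).
Proof.
split; last by rewrite part_adj_comp adjK.
by rewrite -part_compA part_comp_adj_comp.
Qed.

Lemma preceq_absorb k (p q : cpart k k) :
  projective p -> projective q -> preceq q p -> part_comp q p = q.
Proof.
move=> [_ pE] [_ qE] [_ pq].
by have := congr1 (@part_adj k k) pq; rewrite part_adj_comp -pE -qE.
Qed.

Section Conjugation.
Variables (k l : nat) (p : cpart k k) (q : cpart l l) (r : cpart k l).
Hypotheses (rp : part_comp (part_adj r) r = p) (rq : part_comp r (part_adj r) = q).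

(** Conjugation by [r*] is undone by conjugation by [r], because [q = r r*] absorbs
    everything below it; this is why it preserves strictness. *)
Lemma prec_conj (q' : cpart l l) : projective q' -> prec q' q ->
  let p' := part_comp (part_adj r) (part_comp q' r) in
  projective p' /\ prec p' p.
Proof.
move=> pq' [q'q q'Dq] p'.
have pq : projective q by rewrite -rq -{1}(adjK r); apply: projective_gram.
have q'qE := preceq_absorb pq pq' q'q.
have [qq _] := pq; have [q'q' q'E] := pq'; have [_ qq'E] := q'q.
split; split.
- rewrite /p' -!part_compA; congr (part_comp _ _).
  rewrite (part_compA r) rq (part_compA q) qq'E part_compA.
  by rewrite q'q'.
- by rewrite /p' !part_adj_comp adjK -q'E part_compA.
- split; first by rewrite -rp !upper_comp.
  by rewrite -rp /p' -!part_compA (part_compA r) rq (part_compA q) qq'E.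
- move=> p'p; apply: q'Dq; have: part_comp r (part_comp p' (part_adj r)) = q.
    by rewrite p'p -rp -part_compA rq part_compA rq qq.
  by rewrite /p' -!part_compA rq q'qE part_compA rq qq'E.
Qed.

End Conjugation.

(** * The linear maps *)

Section LinearMaps.
Variables (C : numClosedFieldType).

(** [T_p] without its normalization. *)
Definition Dmap (N : nat) k l (p : cpart k l) : 'M[C]_(tdim N l, tdim N k) :=
  \matrix_(j, i) (delta_part p (enum_val i) (enum_val j))%:R.

Section Counting.
Variable n : nat.
Let L := 'I_n.+1.

Definition zero_lab k : k.-tuple L := nseq_tuple k 0.

(** This is [N] to the number of loops removed when [q p] is formed; by linearity,
    outer labels other than [0] that can be completed give the same number. *)
Definition middle_labels k l m (q : cpart l m) (p : cpart k l) :=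
  #|[set j : l.-tuple L | delta_part p (zero_lab k) j && delta_part q j (zero_lab m)]%SET|.

Lemma tnth_zero_lab k : tnth (zero_lab k) =1 (fun=> 0).
Proof. by move=> a; rewrite tnth_nseq. Qed.

Lemma middle_labels_gt0 k l m (q : cpart l m) (p : cpart k l) :
  (0 < middle_labels q p)%N.
Proof.
apply/card_gt0P; exists (zero_lab l); rewrite inE; apply/andP.
by split; apply/delta_partP; apply: (eq_rel_of _ _ (@rel_of_cst _ _ _ _ 0));
  move=> a; rewrite tnth_zero_lab.
Qed.

(** The middle labellings completing given outer ones form a coset of the group
    of those completing the zero labellings, as soon as there is one of them. *)
Lemma Dmap_comp k l m (q : cpart l m) (p : cpart k l) :
  Dmap n.+1 q *m Dmap n.+1 p = (middle_labels q p)%:R *: Dmap n.+1 (part_comp q p).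
Proof.
apply/matrixP => h' i'; rewrite !mxE.
set h := enum_val h'; set i := enum_val i'.
under eq_bigr => j' _ do rewrite !mxE -natrM mulnb.
rewrite -(big_enum_val (fun j : l.-tuple L => (delta_part q j h && delta_part p i j)%:R)) /=.
rewrite -natr_sum -natrM; congr (_%:R).
have compP : reflect (exists j : l.-tuple L, delta_part q j h && delta_part p i j)
    (delta_part (part_comp q p) i h).
  apply: (iffP (delta_partP _ _ _)) =>
    [/(rel_of_comp _ _ (0 : L)) [j [pij qjh]]|[j /andP[qjh pij]]].
    exists [tuple j a | a < l]; apply/andP.
    by split; apply/delta_partP; [apply: eq_rel_of qjh|apply: eq_rel_of pij] => a //;
      rewrite tnth_mktuple.
  by apply/(rel_of_comp _ _ (0 : L)); exists (tnth j); split; apply/delta_partP.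
case: compP => [[j0 /andP[/delta_partP qj0 /delta_partP pj0]]|noj]; last first.
  rewrite muln0 big1 // => j _; case: (boolP (_ && _)) => // qpj.
  by case: noj; exists j.
pose sh (j : l.-tuple L) : l.-tuple L := [tuple tnth j a + tnth j0 a | a < l].
pose sh' (j : l.-tuple L) : l.-tuple L := [tuple tnth j a - tnth j0 a | a < l].
have shK : cancel sh sh'.
  by move=> j; apply: eq_from_tnth => a; rewrite !tnth_mktuple addrK.
have sh'K : cancel sh' sh.
  by move=> j; apply: eq_from_tnth => a; rewrite !tnth_mktuple subrK.
rewrite muln1 (reindex sh) /=; last by exists sh' => j _; [apply: shK|apply: sh'K].
rewrite /middle_labels -sum1dep_card [RHS]big_mkcond /=.
apply: eq_bigr => j _; rewrite andbC; congr (nat_of_bool (_ && _)).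
- apply/delta_partP/delta_partP => [H|/(rel_of_add _ _ pj0) H].
    apply/(rel_of_add _ _ pj0); apply: eq_rel_of H => a.
      by rewrite tnth_zero_lab add0r.
    by rewrite tnth_mktuple.
  apply: eq_rel_of H => a; first by rewrite tnth_zero_lab add0r.
  by rewrite tnth_mktuple.
- apply/delta_partP/delta_partP => [H|/(rel_of_add _ _ qj0) H].
    apply/(rel_of_add _ _ qj0); apply: eq_rel_of H => a.
      by rewrite tnth_mktuple.
    by rewrite tnth_zero_lab add0r.
  apply: eq_rel_of H => a; last by rewrite tnth_zero_lab add0r.
  by rewrite tnth_mktuple.
Qed.

Lemma delta_part_adj N k l (p : cpart k l) (i : k.-tuple 'I_N) (j : l.-tuple 'I_N) :
  delta_part (part_adj p) j i = delta_part p i j.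
Proof. by apply/delta_partP/delta_partP => /rel_of_adj. Qed.

Lemma Dmap_adj N k l (p : cpart k l) : Dmap N (part_adj p) = (Dmap N p) ^t*.
Proof. by apply/matrixP => i j; rewrite !mxE delta_part_adj conjC_nat. Qed.

(** Labellings which vanish on the through-blocks are free on the other blocks;
    they consist of an upper and a lower half, which for a self-adjoint partition
    are equinumerous. *)
Lemma middle_labels_projective k (p : cpart k k) : projective p ->
  (middle_labels p p ^ 2 = n.+1 ^ nonthrough p)%N.
Proof.
move=> [_ pE].
set A := [set j : k.-tuple L | delta_part p (zero_lab k) j]%SET.
have midE : middle_labels p p = #|A|.
  apply: eq_card => j; rewrite !inE -[X in _ && X]delta_part_adj -pE.
  exact: andbb.
rewrite midE -mulnn -cardsX.
set D := [set B in blocks p | ~~ through B]%SET.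
have blockD x : (block_of p x \in D) = ~~ through (block_of p x).
  by rewrite inE block_of_mem.
have halfE (t : k.-tuple L) :
    (t \in A) = delta_part p t (zero_lab k) by rewrite inE -delta_part_adj -pE.
have -> : (n.+1 ^ nonthrough p)%N = #|pffun_on (0 : L) (mem D) (predT : pred L)|.
  by rewrite card_pffun_on card_ord.
(* [F] reads the two halves of a labelling off the labels of the blocks. *)
pose F (g : {ffun {set points k k} -> L}) : k.-tuple L * k.-tuple L :=
  ([tuple g (block_of p (inl a)) | a < k], [tuple g (block_of p (inr a)) | a < k]).
have FE g x : glue (tnth (F g).1) (tnth (F g).2) x = g (block_of p x).
  by case: x => a /=; rewrite tnth_mktuple.
rewrite -(@card_in_imset _ _ F (pffun_on 0 (mem D) predT)); last first.
  move=> g g' /pffun_onP[/supportP gD _] /pffun_onP[/supportP g'D _] eqF.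
  apply/ffunP => B; case: (boolP (B \in D)) => [|BD]; last by rewrite gD ?g'D.
  rewrite inE => /andP[pB _].
  have [x xB] : exists x, x \in B.
    by apply/set0Pn; apply: (partition_neq0 (cpart_partition p) pB).
  by move: xB; rewrite (block_ofP _ pB) => /eqP <-; rewrite -!FE eqF.
apply: eq_card => -[t t']; rewrite inE; apply/andP/imsetP => /=; last first.
  case=> g /pffun_onP[/supportP gD _] Fg.
  have g0 a b : block_of p (inl a) = block_of p (inr b) -> g (block_of p (inl a)) = 0.
    move=> eab; apply: gD; rewrite blockD negbK; apply/andP.
    by split; apply/existsP; [exists a|exists b]; rewrite ?mem_block_of // eab mem_block_of.
  have [-> ->] : t = (F g).1 /\ t' = (F g).2 by rewrite -Fg.
  rewrite halfE inE; split; apply/delta_partP => -[a|a] [b|b] eab //=;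
    rewrite ?tnth_zero_lab ?tnth_mktuple ?eab //.
  - by rewrite -eab (g0 _ _ eab).
  - by rewrite (g0 _ _ (esym eab)).
  - by rewrite -eab (g0 _ _ eab).
  - by rewrite (g0 _ _ (esym eab)).
rewrite halfE inE => -[/delta_partP pt0 /delta_partP p0t].
have throughP x : through (block_of p x) -> glue (tnth t) (tnth t') x = 0.
  case/andP => /existsP[a] + /existsP[b]; rewrite !(block_ofP _ (block_of_mem p x)).
  move=> /eqP ea /eqP eb; case: x ea eb => c ea eb /=.
    by have /= := pt0 _ _ (esym eb); rewrite tnth_zero_lab.
  by have /= := p0t _ _ ea; rewrite tnth_zero_lab.
have freeP x y : block_of p x = block_of p y ->
    glue (tnth t) (tnth t') x = glue (tnth t) (tnth t') y.
  move=> exy; have [tx|] := boolP (through (block_of p x)).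
    by rewrite !throughP // -exy.
  case: x y exy => a [] b exy.
  - by move=> _; apply: pt0 exy.
  - case/negP; apply/andP; split; apply/existsP; [exists a|exists b];
      by rewrite ?mem_block_of // exy mem_block_of.
  - case/negP; apply/andP; split; apply/existsP; [exists b|exists a];
      by rewrite ?mem_block_of // exy mem_block_of.
  - by move=> _; apply: p0t exy.
pose g : {ffun {set points k k} -> L} := [ffun B =>
  if B \in D then if [pick x in B] is Some x then glue (tnth t) (tnth t') x else 0 else 0].
have gE x : g (block_of p x) = glue (tnth t) (tnth t') x.
  rewrite ffunE blockD; case: ifP => [_|/negbFE/throughP-> //].
  case: pickP => [y|/(_ x)]; last by rewrite mem_block_of.
  by rewrite (block_ofP _ (block_of_mem p x)) => /eqP/freeP.
exists g.
  apply/pffun_onP; split=> //; apply/supportP => B BD.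
  by rewrite ffunE (negPf BD).
by congr (_, _); apply: eq_from_tnth => a; rewrite tnth_mktuple gE.
Qed.

End Counting.
End LinearMaps.

(** * Adjoints and projections *)

Section Adjoint.
Variable C : numClosedFieldType.

Lemma adjmxM m n o (A : 'M[C]_(m, n)) (B : 'M[C]_(n, o)) :
  (A *m B) ^t* = B ^t* *m A ^t*.
Proof. by rewrite trmx_mul map_mxM. Qed.

Lemma adjmxB m n (A B : 'M[C]_(m, n)) : (A - B) ^t* = A ^t* - B ^t*.
Proof. by rewrite linearB map_mxB. Qed.

Lemma adjmxZ m n a (A : 'M[C]_(m, n)) : (a *: A) ^t* = a^* *: A ^t*.
Proof. by rewrite linearZ map_mxZ. Qed.

Lemma adjmx1 n : (1%:M : 'M[C]_n) ^t* = 1%:M.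
Proof. by rewrite trmx1 map_mx1. Qed.

Lemma adjmx_sum m n (I : Type) (s : seq I) (Q : pred I)
    (F : I -> 'M[C]_(m, n)) :
  (\sum_(i <- s | Q i) F i) ^t* = \sum_(i <- s | Q i) (F i) ^t*.
Proof. by rewrite linear_sum map_mx_sum. Qed.

Lemma adjmx0 m n : (0 : 'M[C]_(m, n)) ^t* = 0.
Proof. by rewrite trmx0 map_mx0. Qed.

(** Diagonal entries of [A* A] are sums of squared absolute values. *)
Lemma sum_gram_eq0 m n (s : seq 'M[C]_(m, n)) :
  \sum_(A <- s) A ^t* *m A = 0 -> forall A, A \in s -> A = 0.
Proof.
move=> s0 A As; apply/matrixP => i j; rewrite mxE.
have /eqP := congr1 (fun M : 'M_n => M j j) s0; rewrite summxE mxE.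
have gE (B : 'M[C]_(m, n)) : (B ^t* *m B) j j = \sum_k `|B k j| ^+ 2.
  by rewrite mxE; apply: eq_bigr => k _; rewrite !mxE mulrC normCK.
have g0 (B : 'M[C]_(m, n)) : 0 <= (B ^t* *m B) j j.
  by rewrite gE sumr_ge0 // => k _; rewrite exprn_ge0.
rewrite psumr_eq0 // => /allP/(_ A As) /=.
rewrite gE psumr_eq0 => [/allP/(_ i (mem_index_enum i))|k _]; last exact: exprn_ge0.
by rewrite /= expf_eq0 normr_eq0 => /eqP.
Qed.

Lemma gram_eq0 m n (A : 'M[C]_(m, n)) : A ^t* *m A = 0 -> A = 0.
Proof.
by move=> A0; apply: (@sum_gram_eq0 _ _ [:: A]); rewrite ?big_seq1 ?inE.
Qed.

End Adjoint.

Section Tmap.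
Variable C : numClosedFieldType.

Definition weight (N : nat) k l (p : cpart k l) : C :=
  (sqrtC N%:R)^-1 ^+ nonthrough p.

Lemma TmapE N k l (p : cpart k l) : Tmap C N p = weight N p *: Dmap C N p.
Proof. by []. Qed.

Lemma weight_gt0 N k l (p : cpart k l) : (0 < N)%N -> 0 < weight N p.
Proof. by move=> N_gt0; rewrite exprn_gt0 // invr_gt0 sqrtC_gt0 ltr0n. Qed.

Lemma Tmap_comp N k l m (q : cpart l m) (p : cpart k l) : (0 < N)%N ->
  exists2 c, 0 < c & Tmap C N q *m Tmap C N p = c *: Tmap C N (part_comp q p).
Proof.
case: N => // n _; have w0 := weight_gt0 _ (ltn0Sn n).
exists (weight n.+1 q * weight n.+1 p * (middle_labels n q p)%:R
        / weight n.+1 (part_comp q p)).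
  by rewrite divr_gt0 ?mulr_gt0 ?w0 ?ltr0n ?middle_labels_gt0.
rewrite !TmapE [RHS]scalerA divfK ?gt_eqF ?w0 //.
by rewrite -scalemxAl -scalemxAr Dmap_comp !scalerA.
Qed.

Lemma Tmap_adj N k l (p : cpart k l) : (0 < N)%N ->
  exists2 c, 0 < c & (Tmap C N p) ^t* = c *: Tmap C N (part_adj p).
Proof.
move=> N_gt0; have w0 k' l' (s : cpart k' l') := weight_gt0 s N_gt0.
exists (weight N p / weight N (part_adj p)); first by rewrite divr_gt0 ?w0.
rewrite !TmapE scalerA divfK ?gt_eqF ?w0 // adjmxZ Dmap_adj.
by rewrite conj_Creal ?ger0_real ?ltW ?w0.
Qed.

(** The normalization makes [T_p] idempotent: gluing [p] to itself leaves
    [sqrt N ^ nonthrough p] middle labellings. *)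
Lemma Tmap_projection N k (p : cpart k k) : (0 < N)%N -> projective p ->
  is_projection (Tmap C N p).
Proof.
case: N => // n _ pp; have [pK pE] := pp.
have w0 := weight_gt0 p (ltn0Sn n); split; last first.
  by rewrite TmapE adjmxZ -Dmap_adj -pE conj_Creal ?ger0_real ?ltW.
rewrite TmapE -scalemxAl -scalemxAr Dmap_comp pK !scalerA; congr (_ *: _).
have s0 : 0 < sqrtC n.+1%:R :> C by rewrite sqrtC_gt0 ltr0n.
have -> : (middle_labels n p p)%:R = sqrtC n.+1%:R ^+ nonthrough p :> C.
  apply/eqP; rewrite -(@eqrXn2 _ 2) ?ler0n ?exprn_ge0 ?ltW // -natrX.
  by rewrite middle_labels_projective // natrX exprAC sqrtCK.
by rewrite -mulrA -exprMn mulVf ?expr1n ?mulr1 // gt_eqF.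
Qed.

Lemma Tmap_neq0 N k l (p : cpart k l) : (0 < N)%N -> Tmap C N p != 0.
Proof.
case: N => // n _; apply/eqP => /matrixP.
move=> /(_ (enum_rank (zero_lab n l)) (enum_rank (zero_lab n k))).
rewrite TmapE !mxE !enum_rankK.
have /delta_partP -> : rel_of p (tnth (zero_lab n k)) (tnth (zero_lab n l)).
  apply: (eq_rel_of _ _ (@rel_of_cst _ _ _ _ 0)) => a; by rewrite tnth_zero_lab.
by move/eqP; rewrite mulr1 gt_eqF ?weight_gt0.
Qed.

End Tmap.

(** * Suprema of projections *)

Section Suprema.
Variable C : numClosedFieldType.

Definition mx_subalg n (H : set 'M[C]_n) :=
  [/\ H 1%:M, forall a A, H A -> H (a *: A), forall A B, H A -> H B -> H (A + B)
    & forall A B, H A -> H B -> H (A *m B)].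

(** The range projection of a Hermitian [S] is a polynomial in [S]: some nonzero
    polynomial [X^a g] with [g(0) != 0] annihilates [S], so [S g(S) = 0] because
    powers of [S] have the same kernel as [S], and [1 - g(S) / g(0)] is the
    projection. *)
Lemma range_projection n (H : set 'M[C]_n) S : mx_subalg H -> H S -> S ^t* = S ->
  exists E K, [/\ H E, is_projection E, E *m S = S & E = S *m K].
Proof.
case: n H S => [|n] H S [H1 HZ HD HM] HS Sadj.
  have all0 (A B : 'M[C]_0) : A = B by rewrite [A]flatmx0 [B]flatmx0.
  by exists S, S; split=> //; split.
have hornerH (g : {poly C}) : H (horner_mx S g).
  elim/poly_ind: g => [|g c IHg]; first by rewrite rmorph0 -(scale0r S); apply: HZ.
  rewrite rmorphD rmorphM /= horner_mx_X horner_mx_C; apply: HD; first exact: HM.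
  by rewrite -scalemx1; apply: HZ.
have ker2 (A : 'M_n.+1) : S *m (S *m A) = 0 -> S *m A = 0.
  by move=> SSA; apply: gram_eq0; rewrite adjmxM Sadj -mulmxA SSA mulmx0.
have [a [g]] := multiplicity_XsubC (char_poly S) 0.
rewrite (monic_neq0 (char_poly_monic S)) /= => g0 charE.
have Sg0 : S *m horner_mx S g = 0.
  have: S ^+ a *m horner_mx S g = 0.
    have := Cayley_Hamilton S; rewrite charE subr0 mulrC rmorphM rmorphXn /=.
    by rewrite horner_mx_X.
  elim: a {charE} => [|[|a] IHa] //; first by rewrite mul1mx => ->; rewrite mulmx0.
  by rewrite !exprS -!mulmxE -!mulmxA => /ker2 SS; apply: IHa; rewrite exprS -mulmxE -mulmxA.
have [h gE] : exists h, g = h * 'X + (g.[0])%:P.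
  have /factor_theorem[h hE] : root (g - (g.[0])%:P) 0.
    by rewrite rootE !hornerE subrr.
  by exists h; rewrite -['X]subr0 -hE subrK.
set c := g.[0] in g0 gE *; have {}g0 : c != 0 by rewrite -rootE.
have gS : horner_mx S g = S *m horner_mx S h + c%:M.
  by rewrite gE mulrC rmorphD rmorphM /= horner_mx_X horner_mx_C.
pose E := S *m (- c^-1 *: horner_mx S h).
have EE : E = 1%:M - c^-1 *: horner_mx S g.
  rewrite gS scalerDr scale_scalar_mx mulVf // /E scaleNr mulmxN scalemxAr.
  by rewrite opprD addrCA subrr addr0.
have ES : E *m S = S.
  rewrite EE mulmxBl mul1mx -scalemxAl.
  have -> : horner_mx S g *m S = S *m horner_mx S g.
    exact: comm_horner_mx.
  by rewrite Sg0 scaler0 subr0.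
have SE : S *m E = S by rewrite EE mulmxBr mulmx1 -scalemxAr Sg0 scaler0 subr0.
exists E, (- c^-1 *: horner_mx S h); split=> //.
  by rewrite EE -scaleNr -(scale1r 1%:M); apply: HD; apply: HZ.
split; first by rewrite {2}/E mulmxA ES.
have EadjE : E ^t* *m E = E ^t*.
  by rewrite {1 3}/E adjmxM Sadj -mulmxA SE.
by have := congr1 (fun A : 'M_n.+1 => A ^t*) EadjE; rewrite adjmxM trmxCK EadjE.
Qed.

Lemma projsup_exists n (H : set 'M[C]_n) (s : seq 'M[C]_n) : mx_subalg H ->
  (forall P, P \in s -> H P /\ is_projection P) ->
  exists S, is_projsup H [set P | P \in s]%classic S.
Proof.
move=> Halg Hs; have [H1 HZ HD HM] := Halg.
pose S := \sum_(P <- s) P.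
have HS : H S.
  rewrite /S; elim: s Hs {S} => [|P s IHs] Hs.
    by rewrite big_nil -(scale0r 1%:M); apply: HZ.
  rewrite big_cons; apply: HD; first by have [] := Hs P (mem_head _ _).
  by apply: IHs => Q Qs; apply: Hs; rewrite inE Qs orbT.
have Sadj : S ^t* = S.
  by rewrite adjmx_sum big_seq [RHS]big_seq; apply: eq_bigr => P /Hs[_ []].
have [E [K [HE [EE Eadj] ES EK]]] := range_projection Halg HS Sadj.
(* Compressing [S] to the kernel of [E] gives [0], a sum of positive terms. *)
have EP P : P \in s -> E *m P = P.
  move=> Ps; have [_ [PP Padj]] := Hs _ Ps.
  suff: P *m (1%:M - E) = 0.
    rewrite mulmxBr mulmx1 => /eqP; rewrite subr_eq0 => /eqP PE.
    by rewrite -{1}Padj -{1}Eadj -adjmxM -PE.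
  apply: (@sum_gram_eq0 _ _ _ [seq Q *m (1%:M - E) | Q <- s]); last exact: map_f.
  rewrite big_map big_seq.
  under eq_bigr => Q /Hs[_ [QQ Qadj]] do
    rewrite adjmxM Qadj adjmxB adjmx1 Eadj mulmxA -(mulmxA (1%:M - E)) QQ -mulmxA.
  rewrite -big_seq -mulmx_sumr -mulmx_suml mulmxA mulmxBl mul1mx ES subrr.
  by rewrite mul0mx.
exists E; split=> // S' _ _ S'P.
rewrite /proj_le EK mulmxA; congr (_ *m _).
by rewrite /S mulmx_sumr big_seq [RHS]big_seq; apply: eq_bigr => P /S'P.
Qed.

Lemma proj_le_adj n (P Q : 'M[C]_n) :
  is_projection P -> is_projection Q -> proj_le P Q -> P *m Q = P.
Proof. by move=> [_ Pa] [_ Qa] PQ; rewrite -{1}Pa -{1}Qa -adjmxM PQ. Qed.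

Lemma proj_le_anti n (P Q : 'M[C]_n) :
  is_projection P -> is_projection Q -> proj_le P Q -> proj_le Q P -> P = Q.
Proof.
by move=> Pp Qp PQ QP; rewrite -[RHS]QP (proj_le_adj Pp Qp).
Qed.

(** [V - V P] has vanishing Gram matrix when [V* V = P] is idempotent. *)
Lemma pisom_source m n (P : 'M[C]_m) (V : 'M[C]_(n, m)) :
  V ^t* *m V = P -> P *m P = P -> V *m P = V.
Proof.
move=> VV PP; apply/eqP; rewrite eq_sym -subr_eq0; apply/eqP/gram_eq0.
have Pa : P ^t* = P by rewrite -VV adjmxM trmxCK.
rewrite adjmxB adjmxM Pa mulmxBl !mulmxBr -!(mulmxA P (V ^t*)).
by rewrite !(mulmxA (V ^t*) V) VV !PP subrr.
Qed.

Lemma pisom_target m n (Q : 'M[C]_n) (V : 'M[C]_(n, m)) :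
  V *m V ^t* = Q -> Q *m Q = Q -> Q *m V = V.
Proof.
move=> VV QQ; have Qa : Q ^t* = Q by rewrite -VV adjmxM trmxCK.
rewrite -[RHS]trmxCK -(@pisom_source _ _ Q (V ^t*)) ?trmxCK //.
by rewrite adjmxM Qa trmxCK.
Qed.

Lemma projection_conj m n (P S : 'M[C]_m) (V : 'M[C]_(n, m)) :
  V ^t* *m V = P -> is_projection S -> S *m P = S -> is_projection (V *m S *m V ^t*).
Proof.
move=> VV [SS Sa] SP; split; last by rewrite !adjmxM trmxCK Sa mulmxA.
by rewrite !mulmxA -(mulmxA (V *m S)) VV -(mulmxA V) SP -(mulmxA V) SS.
Qed.

End Suprema.

(** * Intertwiners *)

Section Intertwiners.
Variables (C : numClosedFieldType) (N : nat) (G : cmqg C N).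

Lemma scal_mxM m n o (A : 'M[C]_(m, n)) (B : 'M[C]_(n, o)) :
  scal_mx (calg G) (A *m B) = scal_mx (calg G) A *m scal_mx (calg G) B.
Proof. exact: (map_mxM (in_alg (calg G))). Qed.

Lemma Hom_comp m n o (u : 'M[calg G]_m) (v : 'M[calg G]_n) (w : 'M[calg G]_o) A B :
  Hom u v A -> Hom v w B -> Hom u w (B *m A).
Proof.
by rewrite /Hom /= => uv vw; rewrite scal_mxM -mulmxA uv mulmxA vw -mulmxA.
Qed.

Lemma Hom_scalar n (u : 'M[calg G]_n) a : Hom u u a%:M.
Proof.
rewrite /Hom /=; have -> : scal_mx (calg G) a%:M = (a%:A)%:M :> 'M_n.
  exact: (map_scalar_mx (in_alg (calg G))).
rewrite mul_scalar_mx; apply/matrixP => i j; rewrite !mxE (bigD1 j) //= big1.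
  by rewrite mxE eqxx mulr1n addr0 -scalerAl -scalerAr mul1r mulr1.
by move=> k /negPf kj; rewrite mxE kj mulr0.
Qed.

Lemma HomZ m n (u : 'M[calg G]_m) (v : 'M[calg G]_n) a A :
  Hom u v A -> Hom u v (a *: A).
Proof. by move=> uvA; rewrite -mul_mx_scalar; apply: Hom_comp (Hom_scalar u a) uvA. Qed.

Lemma HomD m n (u : 'M[calg G]_m) (v : 'M[calg G]_n) A B :
  Hom u v A -> Hom u v B -> Hom u v (A + B).
Proof.
rewrite /Hom /= => uvA uvB.
have -> : scal_mx (calg G) (A + B) = scal_mx (calg G) A + scal_mx (calg G) B.
  by apply/matrixP => i j; rewrite !mxE scalerDl.
by rewrite mulmxDl mulmxDr uvA uvB.
Qed.

Lemma Hom_subalg n (u : 'M[calg G]_n) : mx_subalg (Hom u u).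
Proof.
split=> [|a A|A B|A B]; [|exact: HomZ|exact: HomD|by move=> uA uB; apply: Hom_comp uB uA].
exact: Hom_scalar.
Qed.

(** The corners disappear because [Q] commutes with [v] while [V] absorbs [P] on
    the right and [Q] on the left. *)
Lemma Hom_corner m n (P : 'M[C]_m) (Q : 'M[C]_n) u v (V : 'M[C]_(n, m)) :
  Hom v v Q -> V *m P = V -> Q *m V = V ->
  (scal_mx (calg G) V *m corner_rep P u = corner_rep Q v *m scal_mx (calg G) V)
  <-> Hom u v V.
Proof.
rewrite /Hom /corner_rep /= => vQ VP QV.
by rewrite mulmxA -scal_mxM VP vQ -mulmxA -scal_mxM QV.
Qed.

Lemma star_generated_subalg : star_subalgebra (star_generated (fund G)).
Proof.
split=> [S [] //|x y Sx Sy S hS gen|x y Sx Sy S hS gen|a x Sx S hS gen|x Sx S hS gen];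
  have [h1 hD hM hZ hs] := hS.
- by apply: hD; [apply: Sx|apply: Sy].
- by apply: hM; [apply: Sx|apply: Sy].
- by apply: hZ; apply: Sx.
- by apply: hs; apply: Sx.
Qed.

(** The evaluation of [C(G)] at the identity permutation is a counit: it maps
    every [u^w] to the identity matrix. *)
Lemma corner_word_rep_eq0 k (w : k.-tuple bool) (P : 'M[C]_(tdim N k)) :
  contains_SN G -> corner_rep P (word_rep G w) = 0 -> P = 0.
Proof.
move=> /(_ 1%g) [chi [[chi1 chiD] chiM chiZ chis chiu]] Pw0.
have [P1 PD PM PZ Ps] := star_generated_subalg.
set Pol := star_generated (fund G) in P1 PD PM PZ Ps chiD chiM chiZ chis.
have Pu i j : Pol (fund G i j) by move=> S _; apply.
have chi0 : chi 0 = 0 by rewrite -(scale0r 1) chiZ // mul0r.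
have P0 : Pol 0 by rewrite -(scale0r 1); apply: PZ.
have chi_letter c i j : Pol (letter_rep G c i j) /\ chi (letter_rep G c i j) = (i == j)%:R.
  case: c => /=; last by split=> //; rewrite chiu perm1.
  by rewrite !mxE; split; [apply: Ps|rewrite chis // chiu perm1 conjC_nat].
have chi_word i j : Pol (word_rep G w i j) /\ chi (word_rep G w i j) = (i == j)%:R.
  rewrite mxE.
  set wij := \prod_(a < k) _.
  have [h1 ->] : Pol wij /\ chi wij
      = \prod_(a < k) (tnth (enum_val i) a == tnth (enum_val j) a)%:R.
    apply: (big_rec2 (fun (x : calg G) y => Pol x /\ chi x = y)) => // a y x _ [Px <-].
    have [Pl chil] := chi_letter (tnth w a) (tnth (enum_val i) a) (tnth (enum_val j) a).
    by split; [apply: PM|rewrite chiM // chil].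
  split=> //; case: (eqVneq i j) => [->|ij]; first by rewrite big1 // => a _; rewrite eqxx.
  have [a aij] : exists a, tnth (enum_val i) a != tnth (enum_val j) a.
    apply/existsP; rewrite -negb_forall; apply: contraNN ij => /forallP eqij.
    by apply/eqP/enum_val_inj/eq_from_tnth => a; apply/eqP.
  by rewrite (bigD1 a) //= (negPf aij) mul0r.
apply/matrixP => i j.
transitivity (chi (corner_rep P (word_rep G w) i j)); last by rewrite Pw0 !mxE chi0.
rewrite /corner_rep [in RHS]mxE.
have [_ ->] : Pol (\sum_k0 scal_mx (calg G) P i k0 * word_rep G w k0 j)
    /\ chi (\sum_k0 scal_mx (calg G) P i k0 * word_rep G w k0 j)
      = \sum_k0 P i k0 * (k0 == j)%:R.
  apply: (big_rec2 (fun (x : calg G) y => Pol x /\ chi x = y)) => // a y x _ [Px <-].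
  have [Pl chil] := chi_word a j.
  rewrite mxE -scalerAl mul1r.
  by split; [apply: PD => //; apply: PZ|rewrite chiD ?chiZ ?chil //; apply: PZ].
rewrite (bigD1 j) //= eqxx mulr1 big1 ?addr0 // => a /negPf->.
by rewrite mulr0.
Qed.

End Intertwiners.

Section EasyQuantumGroup.
Variables (C : numClosedFieldType) (N : nat) (G : cmqg C N).
Variable Cat : forall k l, {set cpart k l}.
Hypotheses (hCat : is_category Cat) (N_gt0 : (0 < N)%N) (hG : unitary_easy G Cat).

Lemma Hom_wordP k l (w : k.-tuple bool) (w' : l.-tuple bool) T :
  Hom (word_rep G w) (word_rep G w') T <->
  exists c : cpart k l -> C,
    T = \sum_(p in [set p in Cat k l | (upper p == w) && (lower p == w')]%SET)
          c p *: Tmap C N p.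
Proof.
rewrite (easy_Hom hG) span_def big_image /=.
split=> [/memv_sumP[v hv ->]|[c ->]].
  have /fin_all_exists[c hc] : forall p, exists a,
      p \in [set p in Cat k l | (upper p == w) && (lower p == w')]%SET -> v p = a *: Tmap C N p.
    move=> p; case: (boolP (p \in _)) => [/hv/vlineP[a ->]|_]; last by exists 0.
    by exists a.
  by exists c; apply: eq_bigr => p /hc.
by apply/memv_sumP; exists (fun p => c p *: Tmap C N p) => // p _; apply/vlineP; exists (c p).
Qed.

Lemma Hom_Tmap k l (r : cpart k l) :
  r \in Cat k l -> Hom (word_rep G (upper r)) (word_rep G (lower r)) (Tmap C N r).
Proof.
move=> rC; apply/(easy_Hom hG); apply: memv_span; apply: fintype.image_f.
by rewrite inE rC !eqxx.
Qed.

Lemma Hom_adj k l (w : k.-tuple bool) (w' : l.-tuple bool) T :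
  Hom (word_rep G w) (word_rep G w') T -> Hom (word_rep G w') (word_rep G w) (T ^t*).
Proof.
move/Hom_wordP => [c ->]; rewrite adjmx_sum.
apply: (big_ind (fun A => Hom (word_rep G w') (word_rep G w) A)).
- by apply/Hom_wordP; exists (fun=> 0); rewrite big1 // => p _; rewrite scale0r.
- by move=> A B; apply: HomD.
- move=> r; rewrite inE => /and3P[rC /eqP<- /eqP<-].
  rewrite adjmxZ; have [a _ ->] := Tmap_adj C r N_gt0.
  by apply/HomZ/HomZ; have := Hom_Tmap (cat_adj hCat rC); rewrite upper_adj lower_adj.
Qed.

(** ** The projections [P_p] *)

(** [T_p T_q] is a multiple of [T_q], and [T_p] is idempotent. *)
Lemma Tmap_le k (p q : cpart k k) : projective p -> preceq q p ->
  Tmap C N p *m Tmap C N q = Tmap C N q.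
Proof.
move=> pp [_ pq]; have [c c0 pqE] := Tmap_comp C p q N_gt0.
have [pK _] := Tmap_projection C N_gt0 pp.
rewrite pq in pqE; have := congr1 (mulmx (Tmap C N p)) pqE.
rewrite mulmxA pK -(scalemxAr c) pqE => /eqP; rewrite -subr_eq0 (scalerA c c) -scalerBl scaler_eq0.
rewrite (negPf (Tmap_neq0 _ _ N_gt0)) orbF subr_eq0 -{1}[c]mulr1.
by rewrite (inj_eq (mulfI (lt0r_neq0 c0))) => /eqP <-; rewrite scale1r.
Qed.

Definition lower_projections k (p : cpart k k) : set 'M[C]_(tdim N k) :=
  [set T | exists q, [/\ q \in Cat k k, projective q, prec q p & T = Tmap C N q]]%classic.

Definition part_sup k (p : cpart k k) :=
  projsup (Hom (word_rep G (upper p)) (word_rep G (upper p))) (lower_projections p).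

Lemma Hom_Tmap_projective k (p : cpart k k) : p \in Cat k k -> projective p ->
  Hom (word_rep G (upper p)) (word_rep G (upper p)) (Tmap C N p).
Proof. by move=> pC pp; rewrite -{2}(projective_lower pp); apply: Hom_Tmap. Qed.

Lemma part_supP k (p : cpart k k) :
  is_projsup (Hom (word_rep G (upper p)) (word_rep G (upper p)))
    (lower_projections p) (part_sup p).
Proof.
rewrite /part_sup /projsup; apply: (@xgetPex _ 0 (is_projsup _ _)).
pose s := [seq Tmap C N q | q in [pred q : cpart k k |
  [&& q \in Cat k k, `[< projective q >] & `[< prec q p >]]]].
have sE : lower_projections p = [set P | P \in s]%classic.
  apply/seteqP; split=> T /=.
    case=> q [qC pq qp ->]; apply/fintype.imageP; exists q => //=.
    by apply/and3P; split=> //; apply/asboolP.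
  by case/fintype.imageP => q /and3P[qC /asboolP pq /asboolP qp] ->; exists q.
rewrite sE; apply: projsup_exists; first exact: Hom_subalg.
move=> P /fintype.imageP[q /and3P[qC /asboolP pq /asboolP [[uq _] _]] ->].
by split; [rewrite -uq; apply: Hom_Tmap_projective|apply: Tmap_projection].
Qed.

Section PartProj.
Variables (k : nat) (p : cpart k k).
Hypotheses (pC : p \in Cat k k) (pp : projective p).

Lemma part_sup_le : proj_le (part_sup p) (Tmap C N p).
Proof.
have [_ _ _] := part_supP p; apply; first exact: Tmap_projection.
  exact: Hom_Tmap_projective.
by move=> Q [q [_ _ [qp _] ->]]; apply: Tmap_le.
Qed.

Let P := part_proj G Cat p.

Lemma part_projE : part_proj G Cat p = Tmap C N p - part_sup p.
Proof. by []. Qed.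

Lemma part_sup_Tmap : part_sup p *m Tmap C N p = part_sup p.
Proof.
apply: proj_le_adj part_sup_le; last exact: Tmap_projection.
by have [] := part_supP p.
Qed.

Lemma part_proj_projection : is_projection P.
Proof.
have [[SS Sa] _ _ _] := part_supP p; have [TT Ta] := Tmap_projection C N_gt0 pp.
split; last by rewrite /P part_projE adjmxB Sa Ta.
rewrite /P part_projE mulmxBl !mulmxBr TT SS part_sup_le part_sup_Tmap.
by rewrite subrr subr0.
Qed.

Lemma Tmap_part_proj : Tmap C N p *m P = P.
Proof.
by rewrite mulmxBr part_sup_le; have [-> _] := Tmap_projection C N_gt0 pp.
Qed.

Lemma lower_part_proj q : q \in Cat k k -> projective q -> prec q p ->
  Tmap C N q *m P = 0.
Proof.
move=> qC pq qp; have [Sp _ Sle _] := part_supP p.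
have qS : proj_le (Tmap C N q) (part_sup p) by apply: Sle; exists q.
rewrite mulmxBr (proj_le_adj (Tmap_projection C N_gt0 pq) Sp qS).
rewrite (proj_le_adj (Tmap_projection C N_gt0 pq) (Tmap_projection C N_gt0 pp)) ?subrr //.
by apply: Tmap_le => //; case: qp.
Qed.

Lemma Hom_part_proj : Hom (word_rep G (upper p)) (word_rep G (upper p)) P.
Proof.
rewrite /P part_projE -scaleN1r; apply: HomD; first exact: Hom_Tmap_projective.
by apply: HomZ; have [] := part_supP p.
Qed.

End PartProj.

(** * Equivalence of the representations [u_p] *)

(** Composition of the [T_r] only respects composition of partitions up to positive
    scalars. The choice of [a] removes the one in [V* V]; the one in [V V*] is then
    [1], since [V V*] is idempotent like [T_q]. *)
Lemma Tmap_partial_isometry k l (p : cpart k k) (q : cpart l l) (r : cpart k l) :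
  projective p -> projective q ->
  part_comp (part_adj r) r = p -> part_comp r (part_adj r) = q ->
  exists a, let V := a *: Tmap C N r in
    V ^t* *m V = Tmap C N p /\ V *m V ^t* = Tmap C N q.
Proof.
move=> pp pq rp rq.
have [x x0 adjr] := Tmap_adj C r N_gt0.
have [y y0 rrp] := Tmap_comp C (part_adj r) r N_gt0.
have [z z0 rrq] := Tmap_comp C r (part_adj r) N_gt0.
rewrite rp in rrp; rewrite rq in rrq.
have [pK _] := Tmap_projection C N_gt0 pp; have [qK _] := Tmap_projection C N_gt0 pq.
have q0 := Tmap_neq0 C q N_gt0.
move: (Tmap C N p) (Tmap C N q) (Tmap C N r) (Tmap C N (part_adj r)) adjr rrp rrq pK qK q0.
move=> P Q R R' adjr rrp rrq pK qK Q0.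
pose a := (sqrtC (x * y))^-1; have a0 : 0 < a by rewrite invr_gt0 sqrtC_gt0 mulr_gt0.
have aa : a^* = a by rewrite conj_Creal ?ger0_real ?ltW.
exists a => /=; set V := a *: R.
have VV : V ^t* *m V = P.
  rewrite adjmxZ aa adjr -!scalemxAl -!scalemxAr rrp !scalerA.
  rewrite (_ : a * x * a * y = (a * a) * (x * y)); last by rewrite mulrACA -!mulrA.
  by rewrite -invfM -expr2 sqrtCK mulVf ?scale1r // mulf_neq0 ?gt_eqF.
split=> //; have [d [d0 VVd]] : exists d, d != 0 /\ V *m V ^t* = d *: Q.
  exists (a * (a * x) * z); split; first by rewrite !mulf_neq0 ?gt_eqF.
  by rewrite adjmxZ aa adjr -!scalemxAl -!scalemxAr rrq !scalerA.
have: (V *m V ^t*) *m (V *m V ^t*) = V *m V ^t*.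
  by rewrite mulmxA -(mulmxA V) VV (pisom_source VV pK).
rewrite VVd -scalemxAl -scalemxAr qK scalerA => /eqP.
rewrite -subr_eq0 -scalerBl scaler_eq0 (negPf Q0) orbF subr_eq0 -[X in _ == X]mulr1.
by rewrite (inj_eq (mulfI d0)) => /eqP ->; rewrite scale1r.
Qed.

(** Conjugation by [r*] maps what lies strictly below [q] strictly below [p], so
    what lies strictly below [q] is dominated by the conjugate of the supremum for
    [p]. Applied to [r] and to [r*], this gives equality of the two suprema. *)
Lemma part_sup_conj k l (p : cpart k k) (q : cpart l l) (r : cpart k l) a :
  p \in Cat k k -> r \in Cat k l -> projective p -> projective q ->
  part_comp (part_adj r) r = p -> part_comp r (part_adj r) = q ->
  let V := a *: Tmap C N r in
  V ^t* *m V = Tmap C N p -> V *m V ^t* = Tmap C N q ->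
  proj_le (part_sup q) (V *m part_sup p *m V ^t*).
Proof.
move=> pC rC pp pq rp rq V VV VVa.
have [Sp HS Sle _] := part_supP p.
have HV : Hom (word_rep G (upper p)) (word_rep G (upper q)) V.
  by rewrite -rp -rq !upper_comp upper_adj; apply/HomZ/Hom_Tmap.
have [_ _ _ ] := part_supP q; apply.
- exact: projection_conj VV Sp (part_sup_Tmap pC pp).
- by apply: Hom_comp (Hom_adj HV) (Hom_comp HS HV).
move=> _ [q' [q'C pq' q'q ->]]; rewrite /proj_le.
have [pp' p'p] := prec_conj rp rq pq' q'q; set p' := part_comp _ _ in pp' p'p.
have Tqq' := Tmap_le pq (proj1 q'q).
have Tq'q := proj_le_adj (Tmap_projection C N_gt0 pq') (Tmap_projection C N_gt0 pq) Tqq'.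
have p'C : p' \in Cat k k.
  have uq' : upper q' = lower r.
    by have [[-> _] _] := q'q; rewrite -rq upper_comp upper_adj.
  have lq' : lower q' = lower r by rewrite projective_lower.
  apply: (cat_comp hCat); first exact: (cat_adj hCat).
    by apply: (cat_comp hCat) => //; rewrite /composable uq'.
  by rewrite /composable lower_comp upper_adj lq'.
have [c VqV] : exists c, V ^t* *m Tmap C N q' *m V = c *: Tmap C N p'.
  have [x _ adjr] := Tmap_adj C r N_gt0.
  have [y _ q'r] := Tmap_comp C q' r N_gt0.
  have [z _ rq'r] := Tmap_comp C (part_adj r) (part_comp q' r) N_gt0.
  exists (a^* * x * (a * y) * z).
  rewrite /V adjmxZ adjr -mulmxA -(scalemxAr a) q'r scalerA (scalerA a) -scalemxAl -scalemxAr.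
  by rewrite rq'r !scalerA -!mulrA.
have SVqV : part_sup p *m (V ^t* *m Tmap C N q' *m V) = V ^t* *m Tmap C N q' *m V.
  by rewrite VqV -(scalemxAr c); congr (_ *: _); apply: Sle; exists p'.
have qE : Tmap C N q' = V *m (V ^t* *m Tmap C N q' *m V) *m V ^t*.
  by rewrite !mulmxA VVa Tqq' -(mulmxA (Tmap C N q')) VVa Tq'q.
rewrite qE; move: (V ^t* *m _ *m V) SVqV => X SX.
rewrite -(mulmxA V X) (mulmxA _ V) -(mulmxA (V *m _)) VV -(mulmxA V).
by rewrite (part_sup_Tmap pC pp) -(mulmxA V) (mulmxA _ X) SX.
Qed.

Lemma part_proj_equivalent k l (p : cpart k k) (q : cpart l l) (r : cpart k l) :
  p \in Cat k k -> q \in Cat l l -> r \in Cat k l -> projective p -> projective q ->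
  part_comp (part_adj r) r = p -> part_comp r (part_adj r) = q ->
  unitarily_equivalent (part_proj G Cat p) (part_rep G Cat p)
                       (part_proj G Cat q) (part_rep G Cat q).
Proof.
move=> pC qC rC pp pq rp rq.
have [a [VV VVa]] := Tmap_partial_isometry pp pq rp rq.
set V := a *: Tmap C N r in VV VVa.
have [b VaE] : exists b, V ^t* = b *: Tmap C N (part_adj r).
  have [x _ adjr] := Tmap_adj C r N_gt0.
  by exists (a^* * x); rewrite adjmxZ adjr scalerA.
have rC' := cat_adj hCat rC.
have [TT _] := Tmap_projection C N_gt0 pp.
have [Sp _ _ _] := part_supP p; have [Sq _ _ _] := part_supP q.
have ST := part_sup_Tmap pC pp; have TSq := part_sup_le qC pq.
have VT : V *m Tmap C N p = V := pisom_source VV TT.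
have Sconj : V *m part_sup p *m V ^t* = part_sup q.
  apply: proj_le_anti => //; first exact: projection_conj VV _ ST.
  - have : proj_le (part_sup p) (V ^t* *m part_sup q *m V).
      rewrite -[X in _ *m X]trmxCK VaE.
      by apply: part_sup_conj => //; rewrite ?adjK // -VaE trmxCK.
    rewrite /proj_le => VSV; rewrite -{2}VSV !mulmxA VVa.
    by rewrite TSq.
  - exact: (part_sup_conj pC rC pp pq rp rq VV VVa).
pose P := part_proj G Cat p; pose Q := part_proj G Cat q.
have [PP Pa] := part_proj_projection pC pp; have [QQ _] := part_proj_projection qC pq.
have WW : (V *m P) *m (V *m P) ^t* = Q.
  rewrite adjmxM Pa mulmxA -(mulmxA V P) PP /P part_projE mulmxBr VT mulmxBl VVa.
  by rewrite Sconj.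
exists (V *m P); split=> //.
  by rewrite adjmxM Pa -mulmxA (mulmxA (V ^t*)) VV (Tmap_part_proj pC pp) PP.
apply/Hom_corner; first exact: Hom_part_proj.
- by rewrite -mulmxA PP.
- exact: pisom_target WW QQ.
- apply: Hom_comp (Hom_part_proj pC pp) _.
  by rewrite -rp -rq !upper_comp upper_adj; apply/HomZ/Hom_Tmap.
Qed.

(** The intertwiner is a combination of maps [P_q T_r P_p]; some [r] contributes,
    and it may be replaced by [q r p]. Then [r* r] lies below [p], and not strictly,
    since [P_p] kills everything strictly below [p]. *)
Lemma part_proj_intertwiner k l (p : cpart k k) (q : cpart l l) (V : 'M[C]_(_, _)) :
  p \in Cat k k -> q \in Cat l l -> projective p -> projective q ->
  Hom (word_rep G (upper p)) (word_rep G (upper q)) V ->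
  part_proj G Cat q *m V *m part_proj G Cat p <> 0 ->
  exists r : cpart k l, r \in Cat k l /\
    part_comp (part_adj r) r = p /\ part_comp r (part_adj r) = q.
Proof.
move=> pC qC pp pq /Hom_wordP[c ->].
set P := part_proj G Cat p; set Q := part_proj G Cat q.
rewrite mulmx_sumr mulmx_suml => QVP.
have [s /and3P[sC /eqP us /eqP ls] QsP] : exists2 s : cpart k l,
    [&& s \in Cat k l, upper s == upper p & lower s == upper q]
    & Q *m Tmap C N s *m P <> 0.
  apply: contrapT => nos; apply: QVP; rewrite big1 // => s; rewrite inE => sC.
  rewrite -(scalemxAr (c s)) -(scalemxAl (c s)).
  suff -> : Q *m Tmap C N s *m P = 0 by rewrite scaler0.
  by apply: contrapT => QsP; apply: nos; exists s.
pose r := part_comp q (part_comp s p).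
have [pK pE] := pp; have [qK qE] := pq.
have spC : part_comp s p \in Cat k l.
  by apply: (cat_comp hCat) => //; rewrite /composable us projective_lower.
have rC : r \in Cat k l.
  by apply: (cat_comp hCat) => //; rewrite /composable lower_comp ls.
have rp : part_comp r p = r by rewrite /r -!part_compA pK.
have qr : part_comp q r = r by rewrite /r part_compA qK.
have prE : part_comp p (part_adj r) = part_adj r.
  by rewrite {1}pE -part_adj_comp rp.
have ur : upper r = upper p by rewrite !upper_comp.
have lr : lower r = upper q by rewrite lower_comp projective_lower.
have QrP : Q *m Tmap C N r *m P <> 0.
  have [x x0 spE] := Tmap_comp C s p N_gt0.
  have [y y0 qspE] := Tmap_comp C q (part_comp s p) N_gt0.
  have QT : Q *m Tmap C N q = Q.
    have [_ Qa] := part_proj_projection qC pq.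
    have [_ Ta] := Tmap_projection C N_gt0 pq.
    by rewrite -[LHS]trmxCK adjmxM Qa Ta (Tmap_part_proj qC pq).
  move=> QrP; apply: QsP.
  have : (x * y) *: (Q *m Tmap C N r *m P) = 0 by rewrite QrP scaler0.
  rewrite (scalemxAl (x * y)) (scalemxAr (x * y)) -(scalerA x) -qspE.
  rewrite (scalemxAr x) -spE !mulmxA QT -(mulmxA _ (Tmap C N p)).
  by rewrite (Tmap_part_proj pC pp).
have adjrC := cat_adj hCat rC.
exists r; split=> //; split; apply: contrapT => neq.
- apply: QrP.
  have [x x0 rE] := Tmap_comp C r (part_comp (part_adj r) r) N_gt0.
  rewrite part_comp_adj_comp in rE.
  have rrC : part_comp (part_adj r) r \in Cat k k.
    by apply: (cat_comp hCat) => //; rewrite /composable upper_adj.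
  have rrP : Tmap C N (part_comp (part_adj r) r) *m P = 0.
    apply: lower_part_proj => //; first exact: projective_gram.
    split=> //; split; first by rewrite upper_comp.
    by rewrite part_compA prE.
  have : x *: (Tmap C N r *m P) = 0.
    by rewrite (scalemxAl x) -rE -mulmxA rrP mulmx0.
  by move/eqP; rewrite scaler_eq0 gt_eqF //= => /eqP rP; rewrite -mulmxA rP mulmx0.
- apply: QrP.
  have [x x0 rE] := Tmap_comp C (part_comp r (part_adj r)) r N_gt0.
  rewrite -part_compA part_comp_adj_comp in rE.
  have rrC : part_comp r (part_adj r) \in Cat l l.
    by apply: (cat_comp hCat) => //; rewrite /composable lower_adj.
  have rrp : projective (part_comp r (part_adj r)).
    by rewrite -{1}(adjK r); apply: projective_gram.
  have rrQ : Tmap C N (part_comp r (part_adj r)) *m Q = 0.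
    apply: lower_part_proj => //.
    split=> //; split; first by rewrite upper_comp upper_adj.
    by rewrite part_compA qr.
  have Qrr : Q *m Tmap C N (part_comp r (part_adj r)) = 0.
    have [_ Qa] := part_proj_projection qC pq.
    have [_ Ta] := Tmap_projection C N_gt0 rrp.
    by rewrite -[LHS]trmxCK adjmxM Qa Ta rrQ adjmx0.
  have : x *: (Q *m Tmap C N r) = 0.
    by rewrite (scalemxAr x) -rE mulmxA Qrr mul0mx.
  by move/eqP; rewrite scaler_eq0 gt_eqF //= => /eqP rP; rewrite rP mul0mx.
Qed.

End EasyQuantumGroup.

Theorem theorem6p7 (R : realType) (Cat : forall k l : nat, {set cpart k l})
    (hCat : is_category Cat) (N : nat) (hN : (0 < N)%N)
    (G : cmqg (complex R) N) (hG : unitary_easy G Cat)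
    (k l : nat) (p : cpart k k) (q : cpart l l)
    (hp : p \in Cat k k) (hq : q \in Cat l l)
    (pp : projective p) (pq : projective q) :
  unitarily_equivalent (part_proj G Cat p) (part_rep G Cat p)
                       (part_proj G Cat q) (part_rep G Cat q)
  <->
  ((exists r : cpart k l, r \in Cat k l /\
      part_comp (part_adj r) r = p /\ part_comp r (part_adj r) = q)
   \/ (part_rep G Cat p = 0%R /\ part_rep G Cat q = 0%R)).
Proof.
have rep0 m (s : cpart m m) : part_rep G Cat s = 0 <-> part_proj G Cat s = 0.
  split; first exact: (corner_word_rep_eq0 (easy_contains_SN hG)).
  move=> P0; rewrite /part_rep P0; apply/matrixP => i j; rewrite !mxE big1 // => a _.
  by rewrite !mxE scale0r mul0r.
split=> [[V [VV VVa /= uV]]|[[r [rC [rp rq]]]|[/rep0 P0 /rep0 Q0]]]; last first.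
- exists 0; rewrite P0 Q0 adjmx0 mul0mx mulmx0; split=> //.
  rewrite (proj2 (rep0 _ _) P0) (proj2 (rep0 _ _) Q0) mulmx0 mul0mx //.
- exact: (part_proj_equivalent hCat hN hG hp hq rC).
have [PP _] := part_proj_projection hN hG hp pp.
have [QQ _] := part_proj_projection hN hG hq pq.
have VP := pisom_source VV PP; have QV := pisom_target VVa QQ.
have [P0|P0] := EM (part_proj G Cat p = 0); [right|left].
  have V0 : V = 0 by rewrite -VP P0 mulmx0.
  by split; apply/rep0 => //; rewrite -VVa V0 mul0mx.
apply: (part_proj_intertwiner hCat hN hG (V := V)) => //.
  by apply/(Hom_corner (word_rep G (upper p)) (Hom_part_proj hN hG hq pq) VP QV).
by rewrite QV VP => V0; apply: P0; rewrite -VV V0 mulmx0.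
Qed.
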